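(* Let $\{w^k=(x^k,\lambda^k)\}_{k\ge 0}$ be a sequence generated by the balanced ALM (from an arbitrary initial point $w^0=(x^0,\lambda^0)\in\mathbb{R}^n\times\mathbb{R}^m$) for the problem $\min\{\theta(x)\mid Ax=b\ (\text{or } Ax\ge b),\ x\in\mathcal{X}\}$, with arbitrary constants $r>0$ and $\delta>0$. For any integer $t>0$, define $$\tilde w_t=(\tilde x_t,\tilde\lambda_t):=\frac{1}{t+1}\sum_{k=0}^t w^{k+1}.$$ Then $\tilde w_t\in\Omega$ and $$\theta(\tilde x_t)-\theta(x)+(\tilde w_t-w)^TF(w)\le\frac{1}{2(t+1)}\|w-w^0\|_H^2,\qquad\forall\, w=(x,\lambda)\in\Omega.$$
   Context: Problem: $\theta:\mathbb{R}^n\to\mathbb{R}$ is a closed proper convex (not necessarily smooth) function, $\mathcal{X}\subseteq\mathbb{R}^n$ is a closed convex set, $A\in\mathbb{R}^{m\times n}$, $b\in\mathbb{R}^m$. The problem is either $\min\{\theta(x)\mid Ax=b,\ x\in\mathcal{X}\}$ (equality case) or $\min\{\theta(x)\mid Ax\ge b,\ x\in\mathcal{X}\}$ (inequality case, componentwise); its solution set is assumed nonempty. Put $\Lambda=\mathbb{R}^m$ in the equality case, $\Lambda=\mathbb{R}^m_+$ in the inequality case, and $\Omega=\mathcal{X}\times\Lambda$. For $w=(x,\lambda)$ let $F(w)=\begin{pmatrix}-A^T\lambda\\ Ax-b\end{pmatrix}$. Balanced ALM: let $r>0,\delta>0$ and $H_0=\frac1r AA^T+\delta I_m$. Given $(x^k,\lambda^k)$,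 set $q_0^k=x^k+\frac1r A^T\lambda^k$ and $$x^{k+1}=\arg\min\{\theta(x)+\tfrac r2\|x-q_0^k\|^2\mid x\in\mathcal{X}\};$$ then set $s_0^k=A(2x^{k+1}-x^k)-b$ and $$\lambda^{k+1}=\arg\min\{\tfrac12(\lambda-\lambda^k)^TH_0(\lambda-\lambda^k)+(s_0^k)^T\lambda\mid\lambda\in\Lambda\}.$$ Let $H=\begin{pmatrix} rI_n & A^T\\ A & \frac1r AA^T+\delta I_m\end{pmatrix}$ and $\|w\|_H^2:=w^THw$; $\|\cdot\|$ is the Euclidean norm. *)

(* Defs.v *)
From mathcomp Require Import all_boot all_order all_algebra.
From mathcomp Require Import all_classical all_reals all_analysis.

Set Implicit Arguments.
Unset Strict Implicit.
Unset Printing Implicit Defensive.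

Import Order.TTheory GRing.Theory Num.Theory.
Import numFieldNormedType.Exports.

Local Open Scope classical_set_scope.
Local Open Scope ring_scope.

(* The linear constraint is A x = b ([Equality]) or A x >= b ([Inequality]). *)
Inductive constraint_kind := Equality | Inequality.

Section BalancedALM.
Variable R : realType.

Definition argmin (T : Type) (f : T -> R) (D : set T) : set T :=
  [set x | D x /\ forall y, D y -> f x <= f y].

Definition closed_function (T : topologicalType) (f : T -> R) : Prop :=
  closed [set p : T * R | f p.1 <= p.2].

Definition dotv (d : nat) (u v : 'cV[R]_d) : R := (u^T *m v) 0 0.

Definition eucl_norm (d : nat) (v : 'cV[R]_d) : R := Num.sqrt (dotv v v).

(* v^T M v; it is the squared M-norm of v *)
Definition quad_form (d : nat) (M : 'M[R]_d) (v : 'cV[R]_d) : R :=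
  (v^T *m M *m v) 0 0.

(* A pair w = (x, lambda) is encoded as the stacked vector col_mx x lambda, so
   that x = usubmx w and lambda = dsubmx w. *)

Variables (n m : nat).
Variables (c : constraint_kind) (theta : 'cV[R]_n -> R) (X : set 'cV[R]_n).
Variables (A : 'M[R]_(m, n)) (b : 'cV[R]_m) (r delta : R).

Definition feasible_set : set 'cV[R]_n :=
  [set x | X x /\ match c with
                  | Equality => A *m x = b
                  | Inequality => forall i, b i 0 <= (A *m x) i 0
                  end].

Definition solution_set : set 'cV[R]_n := argmin theta feasible_set.

Definition Lambda : set 'cV[R]_m :=
  match c with
  | Equality => setT
  | Inequality => [set l | forall i, 0 <= l i 0]
  end.

Definition Omega : set 'cV[R]_(n + m) :=
  [set w | X (usubmx w) /\ Lambda (dsubmx w)].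

Definition F (w : 'cV[R]_(n + m)) : 'cV[R]_(n + m) :=
  col_mx (- (A^T *m dsubmx w)) (A *m usubmx w - b).

Definition H0 : 'M[R]_m := r^-1 *: (A *m A^T) + delta%:M.

Definition H : 'M[R]_(n + m) := block_mx r%:M A^T A H0.

(* Both subproblems are strongly convex when r and delta are positive, so
   membership in argmin determines the next iterate. *)
Definition balanced_ALM (w : nat -> 'cV[R]_(n + m)) : Prop :=
  forall k : nat,
    let xk := usubmx (w k) in
    let lk := dsubmx (w k) in
    let xk1 := usubmx (w k.+1) in
    let lk1 := dsubmx (w k.+1) in
    let q0 := xk + r^-1 *: (A^T *m lk) in
    let s0 := A *m (2 *: xk1 - xk) - b in
    argmin (fun x => theta x + r / 2 * eucl_norm (x - q0) ^+ 2) X xk1 /\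
    argmin (fun l => 1 / 2 * quad_form H0 (l - lk) + dotv s0 l) Lambda lk1.

End BalancedALM.

(* Main.v *)
Require Import Defs.
From mathcomp Require Import all_boot all_order all_algebra.
From mathcomp Require Import all_classical all_reals all_analysis.
From mathcomp Require Import ring lra.
Import Order.TTheory GRing.Theory Num.Theory.
Import numFieldNormedType.Exports.
Local Open Scope classical_set_scope.
Local Open Scope ring_scope.

(** The method is a proximal point method in the H-norm.  The optimality
    conditions of the two subproblems ([argmin_first_order]) add up, at any w
    in Omega, to

      theta(x) - theta(x^{k+1}) + (w - w^{k+1})^T (F(w) + H (w^{k+1} - w^k)) >= 0.

    Each subproblem contributes the value of F at w^{k+1}; it may be replaced
    by the value at w because the linear part of F is skew-symmetric.  The
    vector s_0^k extrapolates x^{k+1} precisely so that the leftover terms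
    assemble into H, which is symmetric.  The polarization identity
    ([quad_form_polarization]) turns the cross term into

      (|w - w^k|_H^2 - |w - w^{k+1}|_H^2 - |w^{k+1} - w^k|_H^2) / 2,

    and the last square can be dropped since H is positive semidefinite
    ([quad_form_H_ge0]).  The resulting one-step estimate ([balanced_ALM_step])
    telescopes over k = 0, ..., t; dividing by t + 1 and applying Jensen's
    inequality to theta ([convex_function_mean]) gives the bound for the
    ergodic mean.  The mean stays in Omega because Omega is convex. *)

(** * Euclidean products and quadratic forms *)

Section EuclideanProduct.
Context {R : realType}.

Lemma dotvC {d} (u v : 'cV[R]_d) : dotv u v = dotv v u.
Proof.
by rewrite /dotv !mxE; apply: eq_bigr => i _; rewrite !mxE mulrC.
Qed.

Lemma dotvDr {d} (u v1 v2 : 'cV[R]_d) :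
  dotv u (v1 + v2) = dotv u v1 + dotv u v2.
Proof. by rewrite /dotv mulmxDr mxE. Qed.

Lemma dotvNr {d} (u v : 'cV[R]_d) : dotv u (- v) = - dotv u v.
Proof. by rewrite /dotv mulmxN mxE. Qed.

Lemma dotvZr {d} (a : R) (u v : 'cV[R]_d) : dotv u (a *: v) = a * dotv u v.
Proof. by rewrite /dotv -scalemxAr mxE. Qed.

Lemma dotvDl {d} (u1 u2 v : 'cV[R]_d) :
  dotv (u1 + u2) v = dotv u1 v + dotv u2 v.
Proof. by rewrite dotvC dotvDr !(dotvC v). Qed.

Lemma dotvNl {d} (u v : 'cV[R]_d) : dotv (- u) v = - dotv u v.
Proof. by rewrite dotvC dotvNr dotvC. Qed.

Lemma dotvZl {d} (a : R) (u v : 'cV[R]_d) : dotv (a *: u) v = a * dotv u v.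
Proof. by rewrite dotvC dotvZr dotvC. Qed.

Definition dotv_linear := (@dotvDl, @dotvDr, @dotvNl, @dotvNr, @dotvZl, @dotvZr).

Lemma dotv_suml {d} (u : nat -> 'cV[R]_d) (v : 'cV[R]_d) (s : seq nat) :
  dotv (\sum_(k <- s) u k) v = \sum_(k <- s) dotv (u k) v.
Proof.
apply: (big_morph (fun u => dotv u v)) => [x y|]; first exact: dotvDl.
by rewrite /dotv trmx0 mul0mx mxE.
Qed.

Lemma dotv_mulmx {d e} (M : 'M[R]_(d, e)) (u : 'cV[R]_d) (v : 'cV[R]_e) :
  dotv u (M *m v) = dotv (M^T *m u) v.
Proof. by rewrite /dotv trmx_mul trmxK mulmxA. Qed.

Lemma dotv_col_mx {d e} (u1 v1 : 'cV[R]_d) (u2 v2 : 'cV[R]_e) :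
  dotv (col_mx u1 u2) (col_mx v1 v2) = dotv u1 v1 + dotv u2 v2.
Proof. by rewrite /dotv tr_col_mx mul_row_col mxE. Qed.

Lemma dotv_ge0 {d} (v : 'cV[R]_d) : 0 <= dotv v v.
Proof.
rewrite /dotv mxE; apply: sumr_ge0 => i _.
by rewrite mxE -expr2 sqr_ge0.
Qed.

Lemma eucl_norm_sqr {d} (v : 'cV[R]_d) : eucl_norm v ^+ 2 = dotv v v.
Proof. by rewrite sqr_sqrtr ?dotv_ge0. Qed.

Lemma quad_formE {d} (M : 'M[R]_d) (v : 'cV[R]_d) :
  quad_form M v = dotv v (M *m v).
Proof. by rewrite /quad_form /dotv mulmxA. Qed.

Lemma dotv_sym {d} (M : 'M[R]_d) (u v : 'cV[R]_d) :
  M^T = M -> dotv u (M *m v) = dotv v (M *m u).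
Proof. by move=> symM; rewrite dotv_mulmx symM dotvC. Qed.

Lemma quad_form_polarization {d} (M : 'M[R]_d) (u v z : 'cV[R]_d) :
  M^T = M ->
  2 * dotv (u - v) (M *m (v - z)) =
  quad_form M (u - z) - quad_form M (u - v) - quad_form M (v - z).
Proof.
move=> symM; rewrite !quad_formE !mulmxBr !dotv_linear.
rewrite (dotv_sym M z u symM) (dotv_sym M v u symM) (dotv_sym M z v symM).
by ring.
Qed.

End EuclideanProduct.

(** * Convexity: segments, means and first-order optimality *)

Section Convexity.
Context {R : realType} {V : lmodType R}.
Implicit Types (D : set V) (f : V -> R) (x y : V).

Let segment_conv x y (a : {i01 R}) :
  (conv a (y : convex_lmodType V) x : V) = x + a%:num *: (y - x).
Proof.
rewrite [LHS]/(_ *: y + (1 - _) *: x) scalerBl scale1r scalerBr.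
by rewrite addrCA.
Qed.

Lemma convex_set_segment D x y (a : R) : @convex_set R V D ->
  D x -> D y -> 0 <= a -> a <= 1 -> D (x + a *: (y - x)).
Proof.
move=> Dconv Dx Dy a0 a1.
have := Dconv y x (Itv01 a0 a1) (mem_set Dy) (mem_set Dx).
by rewrite segment_conv => /set_mem.
Qed.

Lemma convex_function_segment D f x y (a : R) : @convex_function R V D f ->
  D x -> D y -> 0 <= a -> a <= 1 ->
  f (x + a *: (y - x)) <= f x + a * (f y - f x).
Proof.
move=> fconv Dx Dy a0 a1.
have := fconv (Itv01 a0 a1) y x (mem_set Dy) (mem_set Dx).
rewrite segment_conv.
suff -> : f x + a * (f y - f x) = a * f y + (1 - a) * f x by [].
by ring.
Qed.

Let mean_weight (t : nat) :
  (t.+2%:R : R)^-1 = (1 - t.+2%:R^-1) * t.+1%:R^-1.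
Proof.
have t1 : (t.+1%:R : R) != 0 by rewrite pnatr_eq0.
have t2 : (t.+2%:R : R) != 0 by rewrite pnatr_eq0.
rewrite -{2}(mulVf t2) -[X in _ * X - _]natr1 mulrDr mulr1 addrK.
by rewrite mulfK.
Qed.

(** A mean of t + 2 terms lies on the segment from the mean of the first
    t + 1 to the last one, which lets two-point convexity drive inductions. *)
Lemma mean_recr (u : nat -> V) (t : nat) :
  let mean s := s.+1%:R^-1 *: \sum_(0 <= k < s.+1) u k in
  mean t.+1 = mean t + (t.+2%:R : R)^-1 *: (u t.+1 - mean t).
Proof.
rewrite /= big_nat_recr //= scalerDr scalerBr addrCA addrC; congr (_ + _).
by rewrite -scaleNr !scalerA -scalerDl {1}mean_weight mulrBl mul1r mulNr.
Qed.

Let invS_itv (t : nat) : 0 <= (t.+1%:R : R)^-1 <= 1.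
Proof. by rewrite invr_ge0 ler0n /= invf_le1 ?ltr0n // ler1n. Qed.

Lemma convex_set_mean D (u : nat -> V) (t : nat) : @convex_set R V D ->
  (forall k, D (u k)) -> D (t.+1%:R^-1 *: \sum_(0 <= k < t.+1) u k).
Proof.
move=> Dconv Du; elim: t => [|t IHt].
  by rewrite big_nat1 invr1 scale1r.
rewrite mean_recr; have /andP[a0 a1] := invS_itv t.+1.
exact: convex_set_segment.
Qed.

Lemma convex_function_mean D f (u : nat -> V) (t : nat) :
  @convex_set R V D -> @convex_function R V D f -> (forall k, D (u k)) ->
  f (t.+1%:R^-1 *: \sum_(0 <= k < t.+1) u k)
    <= t.+1%:R^-1 * \sum_(0 <= k < t.+1) f (u k).
Proof.
move=> Dconv fconv Du; elim: t => [|t IHt].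
  by rewrite !big_nat1 invr1 scale1r mul1r.
have /andP[a0 a1] := invS_itv t.+1.
rewrite mean_recr.
apply: le_trans (convex_function_segment _ _ _ _ _ fconv _ _ a0 a1) _ => //.
  exact: convex_set_mean.
rewrite [X in _ <= _ * X]big_nat_recr //=.
rewrite mulrBr mulrDr addrCA addrC lerD2r [X in _ <= X * _]mean_weight -mulrA.
rewrite -[X in X - _]mul1r -mulrBl.
by rewrite ler_wpM2l // subr_ge0.
Qed.

(** If the slope L towards y were negative, it would outweigh the quadratic
    term along a short enough step, and that step would beat z. *)
Lemma argmin_first_order D f z y (L Q : R) : @convex_set R V D ->
  argmin f D z -> D y ->
  (forall a, 0 <= a -> a <= 1 ->
     f (z + a *: (y - z)) <= f z + a * L + a ^+ 2 * Q) ->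
  0 <= L.
Proof.
move=> Dconv [Dz zmin] Dy fle; rewrite leNgt; apply/negP => L0.
(* At this step length, L + a |Q| = a L < 0. *)
pose a := - L / (`|Q| - L).
have den0 : 0 < `|Q| - L by have := normr_ge0 Q; lra.
have a0 : 0 < a by rewrite divr_gt0 // oppr_gt0.
have a1 : a <= 1 by rewrite ler_pdivrMr // mul1r; have := normr_ge0 Q; lra.
have Da := convex_set_segment D z y a Dconv Dz Dy (ltW a0) a1.
have := le_trans (zmin _ Da) (fle a (ltW a0) a1).
rewrite -addrA lerDl expr2 -mulrA -mulrDr pmulr_rge0 // => LQ.
have aQ : a * Q <= a * `|Q| by rewrite ler_pM2l // ler_norm.
have aE : a * `|Q| = a * L - L by rewrite /a; field; rewrite gt_eqF.
have : a * L < 0 by rewrite pmulr_rlt0.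
by lra.
Qed.

End Convexity.

(** * The balanced augmented Lagrangian method *)

Section BalancedALM.
Context {R : realType} {n m : nat}.
Variables (c : constraint_kind) (theta : 'cV[R]_n -> R) (X : set 'cV[R]_n).
Variables (A : 'M[R]_(m, n)) (b : 'cV[R]_m) (r delta : R).
Hypotheses (r_gt0 : 0 < r) (delta_gt0 : 0 < delta).

Lemma H0_sym : (H0 A r delta)^T = H0 A r delta.
Proof. by rewrite /H0 linearD linearZ /= trmx_mul trmxK tr_scalar_mx. Qed.

Lemma H_sym : (H A r delta)^T = H A r delta.
Proof. by rewrite /H tr_block_mx H0_sym trmxK tr_scalar_mx. Qed.

Lemma mul_H_col_mx (x : 'cV[R]_n) (l : 'cV[R]_m) :
  H A r delta *m col_mx x l =
  col_mx (r *: x + A^T *m l) (A *m x + H0 A r delta *m l).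
Proof. by rewrite /H mul_block_col mul_scalar_mx. Qed.

(** Completing the square: the form is
    [r * |x + r^-1 A^T l|^2 + delta * |l|^2]. *)
Lemma quad_form_H_ge0 (v : 'cV[R]_(n + m)) : 0 <= quad_form (H A r delta) v.
Proof.
rewrite quad_formE -[v]vsubmxK; set x := usubmx v; set l := dsubmx v.
rewrite mul_H_col_mx dotv_col_mx.
set y := x + r^-1 *: (A^T *m l).
suff -> : dotv x (r *: x + A^T *m l) + dotv l (A *m x + H0 A r delta *m l) =
    r * dotv y y + delta * dotv l l.
  by rewrite addr_ge0 // mulr_ge0 ?dotv_ge0 ?ltW.
rewrite /y /H0 mulmxDl mul_scalar_mx -scalemxAl -mulmxA !dotv_linear.
rewrite (dotv_mulmx A) (dotv_mulmx A) (dotvC (A^T *m l) x).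
by field; rewrite gt_eqF.
Qed.

Lemma convex_Lambda : @convex_set R 'cV[R]_m (Lambda c).
Proof.
move=> x y a; rewrite !inE /Lambda; case: c => //= x0 y0 i.
rewrite [conv _ _ _]/(_ *: x + _ *: y) !mxE.
by rewrite addr_ge0 // mulr_ge0 // subr_ge0.
Qed.

Lemma convex_Omega : @convex_set R 'cV[R]_n X ->
  @convex_set R 'cV[R]_(n + m) (Omega c X).
Proof.
move=> Xconv x y a; rewrite !inE => -[Xx Lx] [Xy Ly]; split.
- rewrite [conv _ _ _]/(_ *: x + _ *: y) linearD !linearZ /=.
  exact/set_mem/(Xconv (usubmx x) (usubmx y) a (mem_set Xx) (mem_set Xy)).
- rewrite [conv _ _ _]/(_ *: x + _ *: y) linearD !linearZ /=.
  exact/set_mem/(convex_Lambda (dsubmx x) (dsubmx y) a (mem_set Lx) (mem_set Ly)).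
Qed.

Lemma primal_step_optimality (q x y : 'cV[R]_n) :
  @convex_function R 'cV[R]_n setT theta -> @convex_set R 'cV[R]_n X ->
  argmin (fun x => theta x + r / 2 * eucl_norm (x - q) ^+ 2) X x -> X y ->
  0 <= theta y - theta x + r * dotv (y - x) (x - q).
Proof.
move=> thconv Xconv xmin Xy.
apply: (argmin_first_order _ _ _ _ _ (r / 2 * dotv (y - x) (y - x))
  Xconv xmin Xy) => a a0 a1.
have thle : theta (x + a *: (y - x)) <= theta x + a * (theta y - theta x).
  exact: convex_function_segment thconv I I a0 a1.
rewrite !eucl_norm_sqr [x + _ - q]addrAC.
move: (theta _) (x - q) (y - x) thle => th e d thle.
rewrite !dotv_linear (dotvC e d).
by lra.
Qed.

Lemma dual_step_optimality (s l0 l y : 'cV[R]_m) :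
  argmin (fun l => 1 / 2 * quad_form (H0 A r delta) (l - l0) + dotv s l)
    (Lambda c) l ->
  Lambda c y ->
  0 <= dotv (y - l) (H0 A r delta *m (l - l0) + s).
Proof.
move=> lmin Ly.
apply: (argmin_first_order _ _ _ _ _
  (1 / 2 * dotv (y - l) (H0 A r delta *m (y - l))) convex_Lambda lmin Ly).
move=> a a0 a1; rewrite !quad_formE.
rewrite addrAC; move: (l - l0) (y - l) => e d.
rewrite !mulmxDr -!scalemxAr !dotv_linear (dotv_sym _ e d H0_sym) (dotvC s d).
by rewrite le_eqVlt; apply/orP; left; apply/eqP; field.
Qed.

(** The sum of the two optimality conditions is a variational inequality for
    the proximal step in the H-norm; polarizing its cross term and discarding
    the square of the increment leaves a right-hand side that telescopes. *)
Lemma balanced_ALM_step (w : nat -> 'cV[R]_(n + m)) (k : nat)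
    (v : 'cV[R]_(n + m)) :
  @convex_function R 'cV[R]_n setT theta -> @convex_set R 'cV[R]_n X ->
  balanced_ALM c theta X A b r delta w -> Omega c X v ->
  theta (usubmx (w k.+1)) - theta (usubmx v) + dotv (w k.+1 - v) (F A b v)
    <= 1 / 2 * (quad_form (H A r delta) (v - w k) -
                quad_form (H A r delta) (v - w k.+1)).
Proof.
move=> thconv Xconv wALM [Xv Lv]; have [xmin lmin] := wALM k.
have Ox := primal_step_optimality _ _ _ thconv Xconv xmin Xv.
have Ol := dual_step_optimality _ _ _ _ lmin Lv.
have pos := quad_form_H_ge0 (w k.+1 - w k).
have pol := quad_form_polarization _ v (w k.+1) (w k) H_sym.
(* F may be taken at v rather than at the new iterate: the two choices differ
   by - dl^T A dx + dx^T A^T dl = 0, where (dx, dl) = v - w k.+1. *)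
suff E : dotv (v - w k.+1) (F A b v) +
    dotv (v - w k.+1) (H A r delta *m (w k.+1 - w k)) =
  r * dotv (usubmx v - usubmx (w k.+1))
     (usubmx (w k.+1) - (usubmx (w k) + r^-1 *: (A^T *m dsubmx (w k)))) +
  dotv (dsubmx v - dsubmx (w k.+1))
    (H0 A r delta *m (dsubmx (w k.+1) - dsubmx (w k)) +
     (A *m (2 *: usubmx (w k.+1) - usubmx (w k)) - b)).
  rewrite -(opprB v) dotvNl.
  by lra.
rewrite /F.
have := (vsubmxK v, vsubmxK (w k.+1), vsubmxK (w k)).
move: (usubmx v) (usubmx (w k.+1)) (usubmx (w k)) => x x1 x0.
move: (dsubmx v) (dsubmx (w k.+1)) (dsubmx (w k)) => l l1 l0.
move=> [[<- <-] <-].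
rewrite !(opp_col_mx, add_col_mx) mul_H_col_mx !dotv_col_mx.
rewrite !mulmxBr -!scalemxAr.
rewrite !dotv_linear !(dotv_mulmx A).
rewrite !(dotvC (A^T *m _)).
by field; rewrite gt_eqF.
Qed.

End BalancedALM.

Theorem theorem3p5 (R : realType) (n m : nat) (c : constraint_kind)
  (theta : 'cV[R]_n -> R) (X : set 'cV[R]_n)
  (A : 'M[R]_(m, n)) (b : 'cV[R]_m) (r delta : R)
  (theta_convex : @convex_function R 'cV[R]_n setT theta)
  (theta_closed : closed_function theta)
  (X_convex : @convex_set R 'cV[R]_n X)
  (X_closed : closed X)
  (sol_nonempty : solution_set c theta X A b !=set0)
  (r_gt0 : 0 < r) (delta_gt0 : 0 < delta)
  (w : nat -> 'cV[R]_(n + m))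
  (w_ALM : balanced_ALM c theta X A b r delta w)
  (t : nat) (t_gt0 : (0 < t)%N) :
  let wt : 'cV[R]_(n + m) := (t.+1%:R)^-1 *: \sum_(0 <= k < t.+1) w k.+1 in
  Omega c X wt /\
  forall v : 'cV[R]_(n + m), Omega c X v ->
    theta (usubmx wt) - theta (usubmx v) + dotv (wt - v) (F A b v)
      <= 1 / (2 * t.+1%:R) * quad_form (H A r delta) (v - w 0%N).
Proof.
move=> wt; split.
  apply: convex_set_mean; first exact: convex_Omega.
  by move=> k; have [[Xk _] [Lk _]] := w_ALM k.
move=> v Ov; set N : R := t.+1%:R.
have N0 : 0 < N by rewrite ltr0n.
set Q := quad_form (H A r delta).
have jensen : theta (usubmx wt)
    <= N^-1 * \sum_(0 <= k < t.+1) theta (usubmx (w k.+1)).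
  rewrite /wt linearZ /= linear_sum /=.
  exact: (convex_function_mean setT theta (fun k => usubmx (w k.+1))).
have sum_le : \sum_(0 <= k < t.+1) (theta (usubmx (w k.+1)) - theta (usubmx v)
      + dotv (w k.+1 - v) (F A b v)) <= 1 / 2 * Q (v - w 0%N).
  apply: (@le_trans _ _ (1 / 2 * (Q (v - w 0%N) - Q (v - w t.+1)))).
    rewrite -opprB -(telescope_sumr (fun k => Q (v - w k))) //.
    rewrite -sumrN mulr_sumr; apply: ler_sum => k _.
    by rewrite opprB; apply: (balanced_ALM_step c _ X).
  have := quad_form_H_ge0 A r delta r_gt0 delta_gt0 (v - w t.+1).
  by rewrite -/Q; lra.
have sumE : \sum_(0 <= k < t.+1) (theta (usubmx (w k.+1)) - theta (usubmx v)
      + dotv (w k.+1 - v) (F A b v)) =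
    \sum_(0 <= k < t.+1) theta (usubmx (w k.+1)) - N * theta (usubmx v) +
    N * dotv (wt - v) (F A b v).
  rewrite big_split sumrB /= sumr_const_nat subn0 -mulr_natl; congr (_ + _).
  rewrite -dotv_suml sumrB sumr_const_nat subn0 -scaler_nat -dotvZl.
  by rewrite scalerBr /wt scalerA divff ?scale1r // gt_eqF.
rewrite sumE in sum_le.
rewrite -(ler_pM2l N0).
have -> : N * (1 / (2 * N) * Q (v - w 0%N)) = 1 / 2 * Q (v - w 0%N).
  by field; rewrite gt_eqF.
rewrite -(ler_pM2l N0) mulVKf ?gt_eqF // in jensen.
by lra.
Qed.
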